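(* Let $f_{ax\_sq}(n)$ denote the maximum size of a point set $P\subseteq[1,n]\times[1,n]$ that does not contain (the vertex set of) an axis-parallel square. Then $$f_{ax\_sq}(n)=\Omega\left(\frac{n^2}{e^{O(\sqrt{\log n})}}\right),$$ that is, there exist constants $c,C>0$ such that $f_{ax\_sq}(n)\ge c\,n^2e^{-C\sqrt{\log n}}$ for all sufficiently large integers $n$.
   Context: Here $[1,n]=\{1,2,\dots,n\}$ is an integer interval, so $[1,n]\times[1,n]$ is the $n\times n$ integer grid in the Euclidean plane. An axis-parallel square is a non-degenerate square whose sides are horizontal and vertical. *)

(* Defs.v *)
From mathcomp Require Import all_boot all_order all_algebra.
From mathcomp Require Import reals sequences exp.

Set Implicit Arguments.
Unset Strict Implicit.
Unset Printing Implicit Defensive.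

(* Ordinals below n.+1 whose value is positive are the integers 1, ..., n. *)
Definition grid (n : nat) : {set 'I_n.+1 * 'I_n.+1} :=
  [set p : 'I_n.+1 * 'I_n.+1 | (0 < p.1) && (0 < p.2)].

(* The corners are (x1, y1), (x2, y1), (x1, y2), (x2, y2). The truncated
   subtractions are exact because x1 < x2 and y1 < y2; their equality says that
   the rectangle is a square. *)
Definition has_ax_square (n : nat) (P : {set 'I_n.+1 * 'I_n.+1}) : bool :=
  [exists x1 : 'I_n.+1, exists x2 : 'I_n.+1,
   exists y1 : 'I_n.+1, exists y2 : 'I_n.+1,
    [&& x1 < x2, y1 < y2, x2 - x1 == y2 - y1 &
        [&& (x1, y1) \in P, (x2, y1) \in P, (x1, y2) \in P
          & (x2, y2) \in P]]].

Definition f_ax_sq (n : nat) : nat :=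
  \max_(P : {set 'I_n.+1 * 'I_n.+1} | (P \subset grid n) && ~~ has_ax_square P)
    #|P|.

(* Main.v *)
Require Import Defs.
From mathcomp Require Import all_boot all_order all_algebra.
From mathcomp Require Import reals sequences exp.
From mathcomp Require Import zify.
Import Order.TTheory GRing.Theory Num.Theory.

(** The corners of an axis-parallel square of side [d] have the values [a - d],
    [a] and [a + d] of [x - y], so the points whose difference [x - y] lies in a
    set without three-term progressions span no square. Behrend's set provides
    the differences: digit vectors with digits below [k] lying on a common
    sphere, read in base [2 k]. Adding two of them produces no carry, so a
    progression of codes is a progression of vectors, and a sphere contains no
    midpoint of two of its distinct points. With [k = 2 ^ m] and dimension [m],
    where [m] is about the square root of the binary logarithm of [n], the
    losses are powers of two with exponent linear in [m]. *)

(** Reducing modulo [B] isolates the units digit; cancelling it and dividing by [B] leaves the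
    shifted digit sequences for the induction. *)
Lemma digits_inj (B D : nat) (a b : nat -> nat) :
  (forall i, i < D -> a i < B) -> (forall i, i < D -> b i < B) ->
  \sum_(i < D) a i * B ^ i = \sum_(i < D) b i * B ^ i ->
  forall i, i < D -> a i = b i.
Proof.
elim: D a b => [|D IHD] a b ltaB ltbB; first by [].
have B_gt0 : 0 < B by apply: leq_ltn_trans (ltaB 0 _).
have step (c : nat -> nat) : \sum_(i < D.+1) c i * B ^ i
    = (\sum_(i < D) c i.+1 * B ^ i) * B + c 0.
  rewrite big_ord_recl muln1 addnC; congr (_ + _).
  by rewrite big_distrl; apply: eq_bigr => i _; rewrite /= /bump expnSr mulnA.
rewrite !step => eq_ab.
have eq0 : a 0 = b 0.
  by have := congr1 (modn^~ B) eq_ab; rewrite /= !modnMDl !modn_small ?ltaB ?ltbB.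
have eqS : \sum_(i < D) a i.+1 * B ^ i = \sum_(i < D) b i.+1 * B ^ i.
  by apply/eqP; rewrite -(eqn_pmul2r B_gt0); apply/eqP; move: eq_ab; lia.
move=> [_|i ltiD] //.
by apply: (IHD (fun i => a i.+1) (fun i => b i.+1)) => // j ltjD; [apply: ltaB | apply: ltbB].
Qed.

Lemma digits_lt (B D : nat) (a : nat -> nat) :
  (forall i, i < D -> a i < B) -> \sum_(i < D) a i * B ^ i < B ^ D.
Proof.
elim: D => [|D IHD] ltaB; first by rewrite big_ord0.
rewrite big_ord_recr /=.
have := IHD (fun i lti => ltaB i (ltnW lti)); have := ltaB D (ltnSn D).
rewrite expnS; move: (B ^ D) (\sum_(_ < D) _) (a D) => p s c ltcB ltsp.
by apply: (@leq_trans (c.+1 * p)); rewrite ?leq_mul2r ?ltcB ?orbT // mulSn ltn_add2r.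
Qed.

Lemma pigeonhole_fiber (T : finType) (M : nat) (f : T -> nat) :
  (forall x, f x < M) -> exists r, #|T| <= M * #|[set x | f x == r]|.
Proof.
move=> ltfM; have [|T_gt0] := posnP #|T|; first by move=> ->; exists 0.
have /card_gt0P[x0 _] := T_gt0.
pose r0 := Ordinal (ltfM x0).
pose F (r : 'I_M) := #|[set x | f x == r]|.
exists (val [arg max_(r > r0) F r]); case: arg_maxnP => //= r _ maxr.
rewrite -sum1_card (partition_big (fun x => Ordinal (ltfM x)) xpredT) //=.
apply: (@leq_trans (\sum_(j < M) F r)); last first.
  by rewrite sum_nat_const card_ord.
apply: leq_sum => j _; apply: leq_trans (maxr j isT).
by rewrite sum1_card /F cardsE; apply: subset_leq_card; apply/subsetP.
Qed.

Section Behrend.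
Variables D k : nat.
Implicit Types u v w : {ffun 'I_D -> 'I_k}.

Definition behrend_code v := \sum_(i < D) v i * (2 * k) ^ i.
Definition sqnorm v := \sum_(i < D) v i ^ 2.

Lemma sqnorm_le v : sqnorm v <= D * k ^ 2.
Proof.
rewrite -[D in D * _]card_ord -sum_nat_const; apply: leq_sum => i _.
by rewrite leq_exp2r // ltnW.
Qed.

(* Extending a digit sequence to [nat] by the junk digit [0]. *)
Let ext (a : 'I_D -> nat) i := oapp a 0 (insub i : option 'I_D).

Let ext_ord a (i : 'I_D) : ext a i = a i.
Proof. by rewrite /ext valK. Qed.

Let ext_lt B a : (forall i, a i < B) -> forall i, i < D -> ext a i < B.
Proof. by move=> ltaB i ltiD; rewrite (ext_ord a (Ordinal ltiD)). Qed.

Let sum_ext B a : \sum_(i < D) a i * B ^ i = \sum_(i < D) ext a i * B ^ i.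
Proof. by apply: eq_bigr => i _; rewrite ext_ord. Qed.

Lemma behrend_code_lt v : behrend_code v < (2 * k) ^ D.
Proof.
rewrite /behrend_code (sum_ext _ (fun i => v i)); apply/digits_lt/ext_lt => i.
by have := ltn_ord (v i); lia.
Qed.

Lemma behrend_code_midpoint u v w :
  behrend_code u + behrend_code w = 2 * behrend_code v ->
  forall i, u i + w i = 2 * v i.
Proof.
rewrite /behrend_code -big_split big_distrr /=.
under eq_bigr do rewrite -mulnDl; under [RHS]eq_bigr do rewrite mulnA.
rewrite (sum_ext _ (fun i => u i + w i)) (sum_ext _ (fun i => 2 * v i)).
move=> eq_sum i; rewrite -(ext_ord (fun i => u i + w i)) -(ext_ord (fun i => 2 * v i)).
apply: digits_inj (ltn_ord i); last exact: eq_sum.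
  by apply: ext_lt => j; have := ltn_ord (u j); have := ltn_ord (w j); lia.
by apply: ext_lt => j; have := ltn_ord (v j); lia.
Qed.

Lemma behrend_code_inj : injective behrend_code.
Proof.
move=> u v eq_uv; apply/ffunP => i; apply: val_inj => /=.
(* Equal codes make [v] the midpoint of [u] and [u]. *)
have := @behrend_code_midpoint u v u _ i; rewrite eq_uv => /(_ ltac:(lia)).
lia.
Qed.

(** The parallelogram law around the midpoint, |u|^2 + |w|^2 = 2|v|^2 + 2|u - v|^2, forces |u - v| =
    0 when the three norms agree. *)
Lemma sphere_midpoint_free u v w :
  sqnorm u = sqnorm v -> sqnorm w = sqnorm v ->
  (forall i, u i + w i = 2 * v i) -> u = v.
Proof.
(* One of the two truncated differences vanishes, so [e i] is the absolute value of u_i - v_i. *)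
move=> nu nw mid; pose e i := (u i - v i) + (v i - u i).
have sum_e : sqnorm u + sqnorm w = 2 * sqnorm v + 2 * \sum_(i < D) e i ^ 2.
  rewrite /sqnorm !big_distrr -!big_split; apply: eq_bigr => i _ /=.
  rewrite /e; have := mid i; move: (u i : nat) (v i : nat) (w i : nat) => a b c.
  rewrite -!mulnn => eq_c; have [leab|/ltnW leba] := leqP a b.
    by rewrite -(subnKC leab) in eq_c *; move: (b - a) eq_c => d eq_c; nia.
  by rewrite -(subnKC leba) in eq_c *; move: (a - b) eq_c => d eq_c; nia.
have /eqP : \sum_(i < D) e i ^ 2 = 0 by lia.
rewrite sum_nat_eq0 => /forallP e0; apply/ffunP => i; apply: val_inj => /=.
by have := e0 i; rewrite /= expn_eq0 /e; lia.
Qed.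

(** The squared norm takes at most [D * k ^ 2 + 1] values, so some sphere holds at least the average
    number of vectors. *)
Lemma behrend : exists S : {set {ffun 'I_D -> 'I_k}},
  k ^ D <= (D * k ^ 2).+1 * #|S| /\
  {in S & &, forall u v w,
     behrend_code u + behrend_code w = 2 * behrend_code v -> u = v}.
Proof.
have [r le_r] := @pigeonhole_fiber _ (D * k ^ 2).+1 sqnorm sqnorm_le.
exists [set v | sqnorm v == r]; split.
  by move: le_r; rewrite card_ffun !card_ord.
move=> u v w; rewrite !inE => /eqP nu /eqP nv /eqP nw /behrend_code_midpoint.
by apply: sphere_midpoint_free; rewrite nv.
Qed.

End Behrend.

Lemma f_ax_sq_ge (n : nat) (T : finType) (S : {set T}) (code : T -> nat) :
  injective code -> (forall v, code v < n./2) ->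
  {in S & &, forall u v w, code u + code w = 2 * code v -> u = v} ->
  #|S| * uphalf n <= f_ax_sq n.
Proof.
move=> code_inj code_lt AP_free.
(* The height is y = [p.2.+1], between 1 and [uphalf n]. As codes are below [n./2], the abscissa
   code + y stays below [n./2 + uphalf n = n], so [inord] truncates nothing. *)
pose pt (p : T * 'I_(uphalf n)) : 'I_n.+1 * 'I_n.+1 :=
  (inord (code p.1 + p.2.+1), inord p.2.+1).
have pt1 p : (pt p).1 = code p.1 + p.2.+1 :> nat.
  by rewrite inordK //; have := code_lt p.1; have := ltn_ord p.2; lia.
have pt2 p : (pt p).2 = p.2.+1 :> nat.
  by rewrite inordK //; have := code_lt p.1; have := ltn_ord p.2; lia.
have pt_inj : injective pt.
  move=> [v y] [w z] eq_pt; have := pt1 (v, y); have := pt2 (v, y).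
  rewrite eq_pt pt1 pt2 /= => -[eq_yz] eq_vw.
  have -> : v = w by apply: code_inj; lia.
  by congr (_, _); apply: val_inj.
pose P := [set pt p | p in setX S [set: 'I_(uphalf n)]].
have -> : #|S| * uphalf n = #|P| by rewrite card_imset // cardsX cardsT card_ord.
rewrite /f_ax_sq.
apply: (leq_bigmax_cond (F := fun Q : {set 'I_n.+1 * 'I_n.+1} => #|Q|)).
apply/andP; split.
  by apply/subsetP => _ /imsetP[p _ ->]; rewrite inE pt1 pt2 addnS.
have inP x y : (x, y) \in P -> exists2 v, v \in S & x = code v + y :> nat.
  case/imsetP => -[v z] /setXP[Sv _] eq_p; exists v => //.
  by have := pt1 (v, z); have := pt2 (v, z); rewrite -eq_p /= => -> ->.
apply/negP => /existsP[x1 /existsP[x2 /existsP[y1 /existsP[y2]]]].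
case/and4P => lt_x lt_y /eqP eq_d /and4P[/inP[v Sv x1y1] /inP[u Su x2y1]].
move=> /inP[w Sw x1y2] _.
have eq_uv : u = v by apply: (AP_free u v w) => //; lia.
(* Equal codes at height [y1] give [x1 = x2], against [x1 < x2]. *)
by rewrite eq_uv in x2y1; lia.
Qed.

(** The lower bound on [n] makes room for codes below (2 * 2^m)^m = 2^(m(m+1)). The upper bound is
    2^(m^2 + 3m + 3); passing to a sphere costs 2^(3m) and halving the height costs 2, which totals
    2^(6m + 4). *)
Lemma f_ax_sq_ge_pow2 (m n : nat) :
  2 ^ (m * m.+1).+1 <= n -> n <= 2 ^ (m.+1 * m.+2).+1 ->
  n ^ 2 <= f_ax_sq n * 2 ^ (6 * m + 4).
Proof.
move=> le_n n_le; have [S [cardS AP_free]] := behrend m (2 ^ m).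
have code_lt v : @behrend_code m (2 ^ m) v < n./2.
  apply: leq_trans (behrend_code_lt _ _ _) _.
  by rewrite -expnS -expnM mulnC; move: le_n; rewrite expnS; lia.
have f_ge := f_ax_sq_ge _ _ _ _ (@behrend_code_inj _ _) code_lt AP_free.
(* The number of norms satisfies m * 4^m + 1 <= 2^m * 4^m, because m < 2^m. *)
have le_S : 2 ^ (m * m) <= 2 ^ (3 * m) * #|S|.
  rewrite expnM; apply: leq_trans cardS _; rewrite leq_mul2r; apply/orP; right.
  have -> : 3 * m = m + m * 2 by lia.
  rewrite expnD -expnM.
  have := ltn_expl m (ltnSn 1); have := expn_gt0 2 (m * 2).
  by move: (2 ^ m) (2 ^ (m * 2)) => a b; nia.
have le_2f : 2 ^ (m * m) * n <= 2 ^ (3 * m + 1) * f_ax_sq n.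
  have le_n2 : n <= 2 * uphalf n by lia.
  apply: leq_trans (leq_mul le_S le_n2) _.
  rewrite expnD expn1 -!mulnA leq_mul2l; apply/orP; right.
  by rewrite mulnCA leq_mul2l f_ge orbT.
rewrite -mulnn; apply: leq_trans (leq_mul n_le (leqnn n)) _.
have -> : (m.+1 * m.+2).+1 = (3 * m + 3) + m * m by lia.
rewrite expnD -mulnA; apply: leq_trans (leq_mul (leqnn _) le_2f) _.
rewrite mulnA -expnD mulnC leq_mul2l; apply/orP; right.
by rewrite leq_exp2l //; lia.
Qed.

Lemma pow2_bracket (n : nat) : 2 <= n ->
  exists m, 2 ^ (m * m.+1).+1 <= n <= 2 ^ (m.+1 * m.+2).+1.
Proof.
move=> n_ge2; pose Q m := 2 ^ (m * m.+1).+1 <= n.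
have exQ : exists m, Q m by exists 0.
have ubQ m : Q m -> m <= n.
  apply: leq_trans; apply: ltnW; apply: leq_trans (ltn_expl m (ltnSn 1)) _.
  by rewrite leq_exp2l //; nia.
(* For the largest such [m], failure of [Q m.+1] is the upper bound. *)
have [m Qm maxm] := ex_maxnP exQ ubQ; exists m; rewrite [X in X && _]Qm /=.
by rewrite leqNgt; apply/negP => /ltnW /maxm; rewrite ltnn.
Qed.

Local Open Scope ring_scope.

Theorem proposition3p20 (R : realType) :
  exists c C : R, 0 < c /\ 0 < C /\
    exists N : nat, forall n : nat, (N <= n)%N ->
      c * n%:R ^+ 2 * expR (- (C * Num.sqrt (ln n%:R))) <= (f_ax_sq n)%:R.
Proof.
have ln2_gt0 : 0 < ln 2 :> R by rewrite ln_gt0 // ltr1n.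
have ln2_ge0 := ltW ln2_gt0.
(* The factor 2^(6m + 4) splits: 2^4 gives c, and 2^(6m) = exp(6 m ln 2) gives C through m ln 2 <=
   sqrt(ln 2) sqrt(ln n), which follows from 2^(m^2) <= n. *)
exists (2 ^- 4), (6 * Num.sqrt (ln 2)); split; first by rewrite invr_gt0 exprn_gt0.
split; first by rewrite mulr_gt0 // sqrtr_gt0.
exists 2%N => n /pow2_bracket[m /andP[le_n n_le]].
have le_m : m%:R * ln 2 <= Num.sqrt (ln 2) * Num.sqrt (ln n%:R) :> R.
  rewrite -sqrtrM // -[leLHS]ger0_norm ?mulr_ge0 //.
  rewrite -sqrtr_sqr ler_sqrt; last first.
    rewrite mulr_ge0 // ln_ge0 // ler1n.
    by apply: leq_trans le_n; rewrite expn_gt0.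
  rewrite exprMn (expr2 (ln 2)) mulrA mulrC ler_pM2l //.
  rewrite -natrX mulr_natl -lnXn // -natrX ler_ln ?posrE ?ltr0n ?expn_gt0 //.
    by rewrite ler_nat; apply: leq_trans le_n; rewrite leq_exp2l //; lia.
  by apply: leq_trans le_n; rewrite expn_gt0.
have le_exp : expR (- (6 * Num.sqrt (ln 2) * Num.sqrt (ln n%:R))) <= 2 ^- (6 * m) :> R.
  rewrite expRN lef_pV2 ?posrE ?expR_gt0 ?exprn_gt0 //.
  rewrite -[leLHS](@lnK R) ?posrE ?exprn_gt0 // ler_expR lnXn //.
  by rewrite -[leLHS]mulr_natl natrM -!mulrA ler_pM2l.
have := f_ax_sq_ge_pow2 _ _ le_n n_le.
rewrite -(ler_nat R) natrM !natrX => le_f.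
apply: le_trans (ler_wpM2l _ le_exp) _; first by rewrite mulr_ge0 // ?invr_ge0 exprn_ge0.
by rewrite mulrAC -invfM mulrC ler_pdivrMr ?mulr_gt0 ?exprn_gt0 // -exprD addnC.
Qed.
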